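(* Let $d\ge2$ and $N\in\mathbb{N}$. The subset of polytopes in general position is open and dense, and has full Lebesgue measure, in $\mathscr{P}_N$.
   Context: A polyhedron is a finite intersection of closed half-spaces of $\mathbb{R}^d$; a polytope is a compact polyhedron; ''faces'' are $(d-1)$-dimensional faces. $\mathcal{P}_N$ is the class of $d$-dimensional polyhedra $P\subset\mathbb{R}^d$ with $0\in\operatorname{int}(P)$ and exactly $N$ faces, and $\mathscr{P}_N\subset\mathcal{P}_N$ is the subset of those that are polytopes. For $(p_1,\dots,p_N)\in(\mathbb{R}^d\setminus\{0\})^N$ put $Q(p_1,\dots,p_N)=\bigcap_{j=1}^N\{x\in\mathbb{R}^d:\langle x,p_j\rangle\le\langle p_j,p_j\rangle\}$, and let $\mathcal{U}$ be the open set of those $(p_1,\dots,p_N)$ for which $Q(p_1,\dots,p_N)$ has exactly $N$ faces. The map $Q:\mathcal{U}\to\mathcal{P}_N$ is onto and locally one-to-one; it is used to give $\mathcal{P}_N$ its smooth structure (topology) and its Lebesgue measure (push-forward by $Q$ of Lebesgue measure on $(\mathbb{R}^d\setminus\{0\})^N$); $\mathscr{P}_N$ carries the induced structures. ''Full Lebesgue measure'' means that the complement in $\mathscr{P}_N$ is a null set. A $d$-dimensional polytope $P$ is in general position if (1) for any set of $d$ faces of $P$, their normals are linearly independent, and (2) the normals to the faces of $P$ incident with any given vertex are linearly independent. *)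

(* Defs.v *)
From HB Require Import structures.
From mathcomp Require Import all_boot all_order all_algebra.
From mathcomp Require Import all_classical all_reals all_analysis.

Set Implicit Arguments.
Unset Strict Implicit.
Unset Printing Implicit Defensive.

Import Order.TTheory GRing.Theory Num.Theory.
Import numFieldNormedType.Exports.

Local Open Scope classical_set_scope.
Local Open Scope ring_scope.

Section Lebesgue.
Variable R : realType.
Local Notation tup n := (n.-tuple (measurableTypeR R)).

Section Step.
Variables (n : nat) (mu : {sigma_finite_measure set (tup n) -> \bar R}).

Let cons_tuple (z : measurableTypeR R * tup n) : tup n.+1 :=
  [tuple of z.1 :: z.2].

Let uncons_tuple (t : tup n.+1) : measurableTypeR R * tup n :=
  (thead t, [tuple of behead t]).

Let cons_tupleK : cancel cons_tuple uncons_tuple.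
Proof. by case=> x t; congr pair; apply: val_inj. Qed.

Let measurable_cons_tuple : measurable_fun setT cons_tuple.
Proof. exact: measurable_cons. Qed.

Let measurable_uncons_tuple : measurable_fun setT uncons_tuple.
Proof.
by apply: measurable_fun_pair; [exact: measurable_tnth|exact: measurable_behead].
Qed.

Definition lebesgue_cons : set (tup n.+1) -> \bar R :=
  pushforward (lebesgue_measure \x mu)%E cons_tuple.

HB.instance Definition _ := Measure.copy lebesgue_cons
  (measure_function_pushforward__canonical__measure_function_Measure
     (lebesgue_measure \x mu)%E measurable_cons_tuple).

Let lebesgue_cons_sigma_finite : sigma_finite setT lebesgue_cons.
Proof.
have /sigma_finiteP[F [TF ndF Foo]] := sigma_finiteT (@lebesgue_measure R).
have /sigma_finiteP[G [TG ndG Goo]] := sigma_finiteT mu.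
exists (fun i => uncons_tuple @^-1` (F i `*` G i)).
  apply/esym; rewrite -preimage_bigcup -subTset => t _.
  have [i _ Fi] : (\bigcup_i F i) (uncons_tuple t).1 by rewrite -TF.
  have [j _ Gj] : (\bigcup_i G i) (uncons_tuple t).2 by rewrite -TG.
  exists (maxn i j) => //; split.
    by move: Fi; apply/subsetPset/ndF/leq_maxl.
  by move: Gj; apply/subsetPset/ndG/leq_maxr.
move=> i; have [mF Fi] := Foo i; have [mG Gi] := Goo i; split.
  rewrite -[X in measurable X]setTI; apply: measurable_uncons_tuple => //.
  exact: measurableX.
rewrite /lebesgue_cons /pushforward -comp_preimage.
rewrite (_ : uncons_tuple \o cons_tuple = id); last first.
  by apply/funext => z /=; rewrite cons_tupleK.
by rewrite preimage_id product_measure1E// lte_mul_pinfty// ge0_fin_numE.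
Qed.

HB.instance Definition _ := Measure_isSigmaFinite.Build _ _ _ lebesgue_cons
  lebesgue_cons_sigma_finite.

End Step.

(* Lebesgue measure on the Borel sets of R^n. *)
Fixpoint lebesgue_tuple (n : nat) :
    {sigma_finite_measure set (tup n) -> \bar R} :=
  if n is m.+1 then lebesgue_cons (lebesgue_tuple m)
  else \d_([tuple] : tup 0).

(* Lebesgue outer measure on the space of matrices, identified with R^(m * n);
   its Caratheodory measurable sets are the Lebesgue measurable sets, and its
   null sets are the Lebesgue null sets. *)
Definition lebesgue_mx (m n : nat) (A : set 'M[R]_(m, n)) : \bar R :=
  ((lebesgue_tuple (m * n))^*)%mu
    [set [tuple (mxvec p ord0 k : measurableTypeR R) | k < m * n] | p in A].

Section MxOuterMeasure.
Local Open Scope ereal_scope.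
Variables m n : nat.

Let lebesgue_mx0 : lebesgue_mx (@set0 'M[R]_(m, n)) = 0.
Proof. by rewrite /lebesgue_mx image_set0 outer_measure0. Qed.

Let lebesgue_mx_ge0 (A : set 'M[R]_(m, n)) : 0 <= lebesgue_mx A.
Proof. exact: outer_measure_ge0. Qed.

Let le_lebesgue_mx :
  {homo @lebesgue_mx m n : A B / A `<=` B >-> A <= B}.
Proof. by move=> A B AB; apply: le_outer_measure; exact: image_subset. Qed.

Let lebesgue_mx_sigma_subadditive : sigma_subadditive (@lebesgue_mx m n).
Proof.
move=> A; rewrite /lebesgue_mx image_bigcup.
exact: outer_measure_sigma_subadditive.
Qed.

HB.instance Definition _ := isOuterMeasure.Build R 'M[R]_(m, n)
  (@lebesgue_mx m n) lebesgue_mx0 lebesgue_mx_ge0 le_lebesgue_mx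
  lebesgue_mx_sigma_subadditive.

End MxOuterMeasure.

End Lebesgue.

Section Polyhedra.
Variables (R : realType) (d : nat).
Implicit Types (P F : set 'rV[R]_d) (x y n v : 'rV[R]_d).

Definition dotp x y : R := \sum_(i < d) x ord0 i * y ord0 i.

Definition polyhedron P :=
  exists (k : nat) (a : 'I_k -> 'rV[R]_d) (b : 'I_k -> R),
    (forall i, a i != 0) /\ P = [set x | forall i, dotp x (a i) <= b i].

(* V is the direction of the affine hull of P. *)
Definition direction P (V : {vspace 'rV[R]_d}) :=
  (forall x y, P x -> P y -> x - y \in V) /\
  (forall W : {vspace 'rV[R]_d},
     (forall x y, P x -> P y -> x - y \in W) -> (V <= W)%VS).

(* The empty set has no dimension here. *)
Definition has_dim P (k : nat) :=
  P !=set0 /\ exists2 V, direction P V & \dim V = k.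

Definition supporting P F n (m : R) :=
  P `<=` [set x | dotp x n <= m] /\ F = P `&` [set x | dotp x n = m].

(* The case n = 0 makes set0 and P improper faces of P. *)
Definition face P F := exists n m, supporting P F n m.

Definition facets P : set (set 'rV[R]_d) :=
  [set F | face P F /\ has_dim F d.-1].

Definition vertex P v := face P [set v].

(* When P has nonempty interior and F is a facet of P, n is determined by F up
   to a positive factor. *)
Definition outer_normal P F n := n != 0 /\ exists m, supporting P F n m.

(* The normals to the members of S, one for each member, are linearly
   independent. *)
Definition independent_normals P (S : set (set 'rV[R]_d)) :=
  forall (k : nat) (F : 'I_k -> set 'rV[R]_d) (n : 'I_k -> 'rV[R]_d),
    injective F -> (forall i, S (F i)) ->
    (forall i, outer_normal P (F i) (n i)) ->
    row_free (\matrix_(i < k) n i).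

Definition general_position P :=
  (forall S, S `<=` facets P -> (S #= `I_d)%card -> independent_normals P S) /\
  (forall v, vertex P v ->
     independent_normals P [set F | facets P F /\ F v]).

End Polyhedra.

Section Space.
Variables (R : realType) (d N : nat).

Definition is_polyhedronN (P : set 'rV[R]_d) :=
  [/\ polyhedron P, has_dim P d, P° 0 & (facets P #= `I_N)%card].

Definition polyhedraN := {P : set 'rV[R]_d | is_polyhedronN P}.

(* The rows of p are the points p_1, ..., p_N. *)
Definition Qset (p : 'M[R]_(N, d)) : set 'rV[R]_d :=
  [set x | forall j, dotp x (row j p) <= dotp (row j p) (row j p)].

Definition Udom : set 'M[R]_(N, d) :=
  [set p | (forall j, row j p != 0) /\ (facets (Qset p) #= `I_N)%card].

Lemma dotp0l (z : 'rV[R]_d) : dotp 0 z = 0.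
Proof. by rewrite /dotp big1// => i _; rewrite mxE mul0r. Qed.

Lemma dotp_gt0 (x : 'rV[R]_d) : x != 0 -> 0 < dotp x x.
Proof.
move=> x0; rewrite lt_neqAle; apply/andP; split; last first.
  by apply: sumr_ge0 => i _; rewrite -expr2 sqr_ge0.
apply: contra x0 => /eqP/esym/eqP.
rewrite psumr_eq0; last by move=> i _; rewrite -expr2 sqr_ge0.
move=> /allP H; apply/eqP/rowP => i; rewrite mxE.
by have := H i (mem_index_enum _); rewrite mulf_eq0 orbb => /eqP.
Qed.

Lemma continuous_dotp (z : 'rV[R]_d) : continuous (fun x => dotp x z).
Proof.
apply: continuous_big => [|i _ x]; first exact: add_continuous.
have /(cvgMr_tmp (b := z ord0 i)) := @coord_continuous R 1 d ord0 i x; exact.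
Qed.

Lemma Qset_polyhedron p : Udom p -> is_polyhedronN (Qset p).
Proof.
move=> [p0 Np].
have Q0 : (Qset p)° 0.
  rewrite /interior.
  apply: (@filter_forall _ _
    (fun j x => dotp x (row j p) <= dotp (row j p) (row j p))
    (nbhs (0 : 'rV[R]_d)) _) => j.
  have : (fun x => dotp x (row j p)) @ (0 : 'rV[R]_d) --> dotp 0 (row j p).
    exact: continuous_dotp.
  rewrite dotp0l => /cvgr_lt /(_ _ (dotp_gt0 (p0 j))).
  by apply: filterS => x /ltW.
split => //.
  exists N, (fun j => row j p), (fun j => dotp (row j p) (row j p)).
  by split.
split; first by exists 0; exact: nbhs_singleton Q0.
exists fullv; last by rewrite dimvf /dim /= mul1n.
split=> [x y _ _|W QW]; first exact: memvf.
apply/subvP => v _.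
have [e e0 Qev] : exists2 e : R, 0 < e & Qset p (e *: v).
  have : (fun e : R => e *: v) @ 0^'+ --> (0 : 'rV[R]_d).
    rewrite -[X in _ --> X](scale0r v); apply: cvg_at_right_filter.
    by apply: cvgZr_tmp; exact: cvg_id.
  move=> /(_ _ Q0) /= H.
  near (0 : R)^'+ => e; exists e => //.
  by near: e; exact: H.
have := QW _ _ Qev (nbhs_singleton Q0); rewrite subr0 => eW.
by rewrite -[v](scalerK (lt0r_neq0 e0)) memvZ.
Unshelve. all: by end_near. Qed.

Definition Q (p : Udom) : polyhedraN :=
  exist _ (Qset (\val p)) (Qset_polyhedron (set_valP p)).

HB.instance Definition _ := gen_eqMixin polyhedraN.
HB.instance Definition _ := gen_choiceMixin polyhedraN.

Let openN : set_system polyhedraN := [set S | open (Q @^-1` S)].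

Let openN_T : openN setT.
Proof. by rewrite /openN /= preimage_setT; exact: openT. Qed.

Let openN_I : setI_closed openN.
Proof. by move=> A B oA oB; rewrite /openN /= preimage_setI; exact: openI. Qed.

Let openN_bigU (I : Type) (f : I -> set polyhedraN) :
  (forall i, openN (f i)) -> openN (\bigcup_i f i).
Proof.
move=> fo; rewrite /openN /= preimage_bigcup; apply: bigcup_open => i _.
exact: fo.
Qed.

(* Q is onto and locally one-to-one, so that the topology for which Q is a local
   homeomorphism is the final topology. *)
HB.instance Definition _ :=
  isOpenTopological.Build polyhedraN openN_T openN_I openN_bigU.

(* Push-forward by Q of Lebesgue measure on Udom. As an outer measure, it needs
   no measurability of Udom. *)
Definition lebesgue_polyhedraN (S : set polyhedraN) : \bar R :=
  lebesgue_mx (\val @` (Q @^-1` S)).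

Let lebesgue_polyhedraN0 : lebesgue_polyhedraN set0 = 0%E.
Proof.
by rewrite /lebesgue_polyhedraN preimage_set0 image_set0 outer_measure0.
Qed.

Let lebesgue_polyhedraN_ge0 S : (0 <= lebesgue_polyhedraN S)%E.
Proof. exact: outer_measure_ge0. Qed.

Let le_lebesgue_polyhedraN :
  {homo lebesgue_polyhedraN : A B / A `<=` B >-> (A <= B)%E}.
Proof.
move=> A B AB; apply: le_outer_measure; apply: image_subset.
exact: preimage_subset.
Qed.

Let lebesgue_polyhedraN_sigma_subadditive :
  sigma_subadditive lebesgue_polyhedraN.
Proof.
move=> A; rewrite /lebesgue_polyhedraN preimage_bigcup image_bigcup.
exact: outer_measure_sigma_subadditive.
Qed.

HB.instance Definition _ := isOuterMeasure.Build R polyhedraN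
  lebesgue_polyhedraN lebesgue_polyhedraN0 lebesgue_polyhedraN_ge0
  le_lebesgue_polyhedraN lebesgue_polyhedraN_sigma_subadditive.

Definition polytopesN : set polyhedraN := [set P | compact (sval P)].

Definition general_polytopesN : set polytopesN :=
  [set P | general_position (sval (\val P))].

End Space.

Arguments polytopesN R d N : clear implicits.
Arguments general_polytopesN R d N : clear implicits.

(* Main.v *)
(* A polyhedron Q(p) has exactly N facets iff every constraint <x, p_j> <=
   |p_j|^2 is irredundant, i.e. is attained at a point where all the others are
   strict; then the facets correspond to the rows of p, which are also their
   normals up to scaling. Hence Q(p) is in general position iff any d rows of p
   are independent and no point of Q(p) lies on d + 1 of the hyperplanes
   <x, p_j> = |p_j|^2. By Cramer's rule this is an open condition on p, and it
   holds wherever finitely many nonzero polynomials in the entries of p do not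
   vanish. The zero set of a nonzero polynomial is null by Fubini, and it has
   empty interior since the polynomial has finitely many zeros on a suitable
   line through any given point. As both the number of facets and compactness
   are preserved under small perturbations of p, density follows. *)
From HB Require Import structures.
Require Import Defs.
From mathcomp Require Import all_boot all_order all_algebra.
From mathcomp Require Import all_classical all_reals all_analysis.
Import Order.TTheory GRing.Theory Num.Theory.
Import numFieldNormedType.Exports.
Local Open Scope classical_set_scope.
Local Open Scope ring_scope.

Set Implicit Arguments.
Unset Strict Implicit.
Unset Printing Implicit Defensive.

(** * Inner product, hyperplanes and their normals *)

Section Dotp.
Variables (R : realType) (d : nat).
Implicit Types x y z n v : 'rV[R]_d.

Lemma dotpC x y : dotp x y = dotp y x.
Proof. by apply: eq_bigr => i _; rewrite mulrC. Qed.

Lemma dotpDl x y z : dotp (x + y) z = dotp x z + dotp y z.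
Proof. by rewrite -big_split; apply: eq_bigr => i _; rewrite mxE mulrDl. Qed.

Lemma dotpZl c x z : dotp (c *: x) z = c * dotp x z.
Proof. by rewrite mulr_sumr; apply: eq_bigr => i _; rewrite mxE mulrA. Qed.

Lemma dotpBl x y z : dotp (x - y) z = dotp x z - dotp y z.
Proof. by rewrite dotpDl -scaleN1r dotpZl mulN1r. Qed.

Lemma dotpDr x y z : dotp x (y + z) = dotp x y + dotp x z.
Proof. by rewrite dotpC dotpDl !(dotpC _ x). Qed.

Lemma dotpZr c x z : dotp x (c *: z) = c * dotp x z.
Proof. by rewrite dotpC dotpZl dotpC. Qed.

Lemma dotp_sumr x (I : finType) (F : I -> 'rV[R]_d) :
  dotp x (\sum_i F i) = \sum_i dotp x (F i).
Proof.
elim/big_ind2: _ => [|u1 v1 u2 v2 <- <-|//]; last by rewrite dotpDr.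
by rewrite dotpC dotp0l.
Qed.

Lemma mulmx_dotp m (A : 'M[R]_(m, d)) x i : (A *m x^T) i ord0 = dotp x (row i A).
Proof. by rewrite mxE; apply: eq_bigr => j _; rewrite !mxE mulrC. Qed.

Lemma dotp_eq0 x : dotp x x = 0 -> x = 0.
Proof. by move=> x0; apply/eqP; apply: contraT => /dotp_gt0; rewrite x0 ltxx. Qed.

(** [V] and the line of [n] are complementary, so [q = v + c *: n] with [v] in [V]. Pairing with [v]
    gives [dotp v v = 0], hence [v = 0]. *)
Lemma hyperplane_normal (V : {vspace 'rV[R]_d}) n q :
  \dim V = d.-1 -> n != 0 -> {in V, forall v, dotp v n = 0} ->
  {in V, forall v, dotp v q = 0} -> exists c, q = c *: n.
Proof.
move=> dV n0 Vn Vq.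
have d0 : (0 < d)%N.
  by case: d n n0 {V dV Vn Vq q} => // n; rewrite [n]thinmx0 eqxx.
have nV : (V :&: <[n]>)%VS = 0%VS.
  apply/eqP; rewrite -subv0; apply/subvP => u /memv_capP[uV /vlineP[c uE]].
  have /eqP : c * dotp n n = 0 by rewrite -dotpZl -uE Vn.
  rewrite mulf_eq0 (gt_eqF (dotp_gt0 n0)) orbF => /eqP c0.
  by rewrite uE c0 scale0r mem0v.
have VnT : (V + <[n]>)%VS = fullv.
  apply/eqP; rewrite eqEdim subvf /= dimvf dimv_disjoint_sum // dim_vline n0 dV.
  by rewrite addn1 prednK // /dim /= mul1n.
have : q \in (V + <[n]>)%VS by rewrite VnT memvf.
move=> /memv_addP[v vV [w /vlineP[c ->] qE]]; exists c.
suff v0 : v = 0 by rewrite qE v0 add0r.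
apply: dotp_eq0; have := Vq v vV.
by rewrite qE dotpDr dotpZr Vn// mulr0 addr0.
Qed.

Definition hyperplane n : {vspace 'rV[R]_d} :=
  lker (linfun (fun x => dotp x n : R^o)).

Lemma mem_hyperplane n v : (v \in hyperplane n) = (dotp v n == 0).
Proof.
have lin_n : linear (fun x => dotp x n : R^o).
  by move=> c x y; rewrite dotpDl dotpZl.
pose f := GRing.isLinear.Build _ _ _ _ _ lin_n.
pose g : {linear 'rV[R]_d -> R^o} := HB.pack (fun x => dotp x n : R^o) f.
by rewrite memv_ker -[X in linfun X]/(GRing.Linear.sort g) lfunE.
Qed.

Lemma dim_hyperplane n : n != 0 -> \dim (hyperplane n) = d.-1.
Proof.
move=> n0; have := limg_ker_dim (linfun (fun x => dotp x n : R^o)) fullv.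
rewrite capfv dimvf -[lker _]/(hyperplane n).
set k := \dim (limg _) => dE.
suff k1 : k = 1%N by move: dE; rewrite k1 addn1 /dim /= mul1n => /(congr1 predn).
apply/eqP; rewrite eqn_leq; apply/andP; split.
  by rewrite (leq_trans (dimvS (subvf _)))// dimvf.
(* A zero image would put [n] itself in the kernel, although [dotp n n > 0]. *)
rewrite lt0n; apply/eqP => k0; move: dE; rewrite k0 addn0 => dE.
have : hyperplane n = fullv by apply/eqP; rewrite eqEdim subvf dE dimvf /=.
move=> hT; have := memvf n; rewrite -hT mem_hyperplane.
by rewrite (gt_eqF (dotp_gt0 n0)).
Qed.

End Dotp.

(** * Facets of [Qset p] and irredundant constraints *)

Section Facets.
Variables (R : realType) (d N : nat) (p : 'M[R]_(N, d)).
Hypotheses (d_gt0 : (0 < d)%N) (p0 : forall j, row j p != 0).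
Local Notation "''p_' j" := (row j p) (at level 0, j at level 2, format "''p_' j").
Implicit Types (F : set 'rV[R]_d) (x y n v : 'rV[R]_d).

Definition tight j := Qset p `&` [set x | dotp x 'p_j = dotp 'p_j 'p_j].

(** Constraints are treated one at a time by taking midpoints: a constraint strict at one end and
    weak at the other is strict at the midpoint. Closure under midpoints stands in for convexity. *)
Lemma strict_point (A : pred 'I_N) F : F !=set0 ->
  F `<=` Qset p -> (forall x y, F x -> F y -> F (2^-1 *: (x + y))) ->
  (forall j, A j -> exists2 y, F y & dotp y 'p_j < dotp 'p_j 'p_j) ->
  exists2 x, F x & forall j, A j -> dotp x 'p_j < dotp 'p_j 'p_j.
Proof.
move=> [x0 Fx0] FQ Fmid FA.
suff [x Fx xA] : exists2 x, F x &
    forall j, j \in enum 'I_N -> A j -> dotp x 'p_j < dotp 'p_j 'p_j.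
  by exists x => // j; apply: xA; rewrite mem_enum.
elim: (enum _) => [|i s [x Fx xs]]; first by exists x0.
have [Ai|Ai] := boolP (A i); last first.
  exists x => // j; rewrite inE => /predU1P[->|]; [by rewrite (negbTE Ai)|exact: xs].
have [y Fy yi] := FA _ Ai.
exists (2^-1 *: (x + y)); first exact: Fmid.
have half j : (dotp (2^-1 *: (x + y)) 'p_j < dotp 'p_j 'p_j) =
    (dotp x 'p_j + dotp y 'p_j < dotp 'p_j 'p_j + dotp 'p_j 'p_j).
  by rewrite dotpZl dotpDl ltr_pdivrMl// mulr_natl mulr2n.
move=> j; rewrite inE half => /predU1P[->|/xs jx] Aj.
  by rewrite ler_ltD//; exact: FQ.
by rewrite ltr_leD ?jx//; exact: FQ.
Qed.

Lemma Qset_mid x y : Qset p x -> Qset p y -> Qset p (2^-1 *: (x + y)).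
Proof.
move=> Qx Qy j; rewrite dotpZl dotpDl ler_pdivrMl// mulr_natl mulr2n.
by apply: lerD; [exact: Qx|exact: Qy].
Qed.

Lemma supporting_mid F n m : supporting (Qset p) F n m ->
  forall x y, F x -> F y -> F (2^-1 *: (x + y)).
Proof.
move=> [_ ->] x y [Qx /= xm] [Qy /= ym]; split; first exact: Qset_mid.
by rewrite /= dotpZl dotpDl xm ym -mulr2n -[m *+ 2]mulr_natl mulKf// pnatr_eq0.
Qed.

Lemma strict_nudge (A : pred 'I_N) x v :
  (forall j, A j -> dotp x 'p_j < dotp 'p_j 'p_j) ->
  exists2 e, 0 < e & forall j, A j -> dotp (x + e *: v) 'p_j < dotp 'p_j 'p_j.
Proof.
move=> xA.
have : \forall e \near 0^'+, forall j, A j ->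
    dotp (x + e *: v) 'p_j < dotp 'p_j 'p_j.
  apply: filter_forall => j; have [Aj|Aj] := boolP (A j); last first.
    by apply: nearW => e.
  have : (fun e => dotp (x + e *: v) 'p_j) @ 0^'+ -->
      dotp x 'p_j + 0 * dotp v 'p_j.
    under eq_fun do rewrite dotpDl dotpZl.
    apply: cvg_at_right_filter; apply: cvgD; first exact: cvg_cst.
    by apply: cvgMr_tmp; exact: cvg_id.
  rewrite mul0r addr0 => /cvgr_lt/(_ _ (xA _ Aj)).
  by apply: filterS.
move=> H; near (0 : R)^'+ => e; exists e => //.
by near: e.
Unshelve. all: by end_near. Qed.

Lemma Qset0 : Qset p 0.
Proof. by move=> j; rewrite dotp0l ltW// dotp_gt0. Qed.

(** With [n = 0] the face would be all of [Qset p], a neighbourhood of 0, whose direction has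
    dimension [d] rather than [d.-1]. *)
Lemma facet_normal_neq0 F n m :
  supporting (Qset p) F n m -> has_dim F d.-1 -> n != 0.
Proof.
move=> [nm FE] [[z Fz] [V [VF _] dV]]; apply/eqP => n0.
have FQ : F = Qset p.
  move: Fz; rewrite FE n0 => -[_ /= <-].
  by rewrite setIidl// => x _ /=; rewrite !(dotpC _ 0) !dotp0l.
suff VT : V = fullv.
  move: dV; rewrite VT dimvf /dim /= mul1n => /eqP.
  by rewrite -[X in X == _]prednK// eqn_leq ltnn.
apply/eqP; rewrite eqEsubv subvf; apply/subvP => v _.
have [|e e0 Qe] := @strict_nudge predT 0 v.
  by move=> j _; rewrite dotp0l dotp_gt0.
have : e *: v \in V.
  rewrite -[_ *: _]subr0; apply: VF; rewrite FQ; last exact: Qset0.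
  by move=> j; rewrite -[_ *: _]add0r; apply/ltW/Qe.
by move=> /(memvZ e^-1); rewrite scalerK// gt_eqF.
Qed.

(** Some constraint [j] is tight on all of [F]. Then [n] and the row [j] are both orthogonal to the
    direction of [F], which has codimension 1, so they are proportional; the factor is positive
    because 0 lies in [Qset p]. *)
Lemma facet_normal F n m : supporting (Qset p) F n m -> has_dim F d.-1 ->
  exists j c, [/\ 0 < c, n = c *: 'p_j & F = tight j].
Proof.
move=> sF hF; have n0 := facet_normal_neq0 sF hF.
move: (sF) hF => [nm FE] [[z Fz] [V [VF Vmin] dV]].
have FQ : F `<=` Qset p by rewrite FE => x [].
have Fn x : F x -> dotp x n = m by rewrite FE => -[].
have [j Fj] : exists j, F `<=` [set x | dotp x 'p_j = dotp 'p_j 'p_j].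
  (* Otherwise some point of [F] satisfies all constraints strictly, and a small step along [n]
     stays in [Qset p] but crosses the supporting hyperplane. *)
  apply: contrapT => /forallNP noj.
  have [||x Fx xs] := @strict_point predT F _ FQ (supporting_mid sF).
  - by exists z.
  - move=> j _; apply: contrapT => Fj; apply: (noj j) => x Fx /=.
    apply/eqP; rewrite eq_le (FQ _ Fx) leNgt; apply/negP => xj.
    by apply: Fj; exists x.
  have [e e0 xe] := @strict_nudge predT x n xs.
  have /nm /= : Qset p (x + e *: n) by move=> j; apply/ltW/xe.
  by rewrite dotpDl dotpZl Fn// gerDl leNgt mulr_gt0// dotp_gt0.
have VW q c : (forall x, F x -> dotp x q = c) -> {in V, forall v, dotp v q = 0}.
  move=> Fq v vV; apply/eqP; rewrite -mem_hyperplane; apply: subvP vV.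
  by apply: Vmin => x y Fx Fy; rewrite mem_hyperplane dotpBl !Fq// subrr.
have [c cE] := hyperplane_normal dV (p0 j) (VW _ _ Fj) (VW _ _ Fn).
have mE : m = c * dotp 'p_j 'p_j by rewrite -(Fn _ Fz) cE dotpZr Fj.
have c0 : 0 < c.
  rewrite lt_neqAle; apply/andP; split.
    by apply: contraNneq n0 => c0; rewrite cE -c0 scale0r.
  have /nm /= := Qset0; rewrite dotp0l mE pmulr_lge0//; exact: dotp_gt0.
exists j, c; split => //; rewrite FE /tight; congr (_ `&` _).
apply/seteqP; split => x /=; rewrite cE dotpZr mE; last by move->.
by move/mulfI; apply; rewrite gt_eqF.
Qed.

Lemma facet_tight F : facets (Qset p) F -> exists j, F = tight j.
Proof.
by move=> [[n [m sF]] hF]; have [j [c [_ _ ->]]] := facet_normal sF hF; exists j.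
Qed.

Lemma supporting_tight j :
  supporting (Qset p) (tight j) 'p_j (dotp 'p_j 'p_j).
Proof. by split=> // x; exact. Qed.

(** From [x], a small step along any vector orthogonal to the row [j] stays in [tight j], so the
    direction of [tight j] is the whole hyperplane. *)
Lemma tight_facet j x : dotp x 'p_j = dotp 'p_j 'p_j ->
  (forall i, i != j -> dotp x 'p_i < dotp 'p_i 'p_i) ->
  facets (Qset p) (tight j).
Proof.
move=> xj xi; split; first by exists 'p_j, (dotp 'p_j 'p_j); exact: supporting_tight.
have tx y : dotp y 'p_j = dotp 'p_j 'p_j ->
    (forall i, i != j -> dotp y 'p_i < dotp 'p_i 'p_i) -> tight j y.
  by move=> yj yi; split=> // i; have [->|/yi/ltW//] := eqVneq i j; rewrite yj.
split; first by exists x; exact: tx.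
exists (hyperplane 'p_j); last exact: dim_hyperplane.
split=> [y z [_ /= yj] [_ /= zj]|W WP].
  by rewrite mem_hyperplane dotpBl yj zj subrr.
apply/subvP => v; rewrite mem_hyperplane => /eqP vj.
have [e e0 xe] := @strict_nudge [pred i | i != j] x v xi.
have : e *: v \in W.
  rewrite -[_ *: _](addKr x) [- x + _]addrC; apply: WP; apply: tx => //.
  by rewrite dotpDl dotpZl vj mulr0 addr0.
by move=> /(memvZ e^-1); rewrite scalerK// gt_eqF.
Qed.

Definition irredundant := forall j, exists2 x, dotp x 'p_j = dotp 'p_j 'p_j &
  forall i, i != j -> dotp x 'p_i < dotp 'p_i 'p_i.

Lemma irredundant_card : irredundant -> (facets (Qset p) #= `I_N)%card.
Proof.
move=> irr; have -> : facets (Qset p) = tight @` [set: 'I_N].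
  apply/seteqP; split=> [F /facet_tight[j ->]|_ [j _ <-]]; first by exists j.
  by have [x xj xi] := irr j; exact: tight_facet xj xi.
have tight_inj : injective tight.
  move=> i j tij; apply/eqP; apply: contraT => ij; have [x xi xj] := irr i.
  have : tight i x.
    by split=> // k; have [->|/xj/ltW//] := eqVneq k i; rewrite xi.
  rewrite tij => -[_ /= xE].
  by have := xj j; rewrite eq_sym => /(_ ij); rewrite xE ltxx.
apply: (@card_eq_trans _ _ _ _ [set: 'I_N]).
  by apply: inj_card_eq => i j _ _; exact: tight_inj.
by rewrite card_eq_sym; exact: card_II.
Qed.

(** An enumeration [h] of the facets factors as [tight \o s]. The map [s] is an injection of a
    finite set into itself, hence invertible, and [tight] is [h] composed with its inverse. *)
Lemma card_tight : (facets (Qset p) #= `I_N)%card ->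
  (forall j, facets (Qset p) (tight j)) /\ injective tight.
Proof.
rewrite card_eq_sym => /card_set_bijP[h [hF hinj hsurj]].
have tightP (k : 'I_N) : exists j, h k = tight j.
  by apply: facet_tight; apply: hF; exact: ltn_ord.
pose s k := projT1 (cid (tightP k)).
have sE (k : 'I_N) : h k = tight (s k) by exact: projT2 (cid (tightP k)).
have s_inj : injective s.
  move=> i j sij; apply/val_inj/hinj; rewrite ?inE /=; try exact: ltn_ord.
  by rewrite !sE sij.
have tightE j : tight j = h (invF s_inj j) by rewrite sE f_invF.
split=> [j|i j]; first by rewrite tightE; apply: hF; exact: ltn_ord.
rewrite !tightE => hij; apply: (can_inj (f_invF s_inj)).
by apply/val_inj/hinj => //; rewrite ?inE /=; exact: ltn_ord.
Qed.

(** By [strict_point] on [tight j], it suffices to make each other constraint [i] strict somewhere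
    on that facet. If [i] were tight on all of it, the row [i] would be a multiple of the row [j];
    comparing right-hand sides makes the factor 1, so both rows would cut out the same facet. *)
Lemma card_irredundant : (facets (Qset p) #= `I_N)%card -> irredundant.
Proof.
move=> /card_tight[tF tinj] j; have [_ [[z [Qz /= zj]] [V [_ Vmin] dV]]] := tF j.
have [||i ij|x [_ /= xj] xi] := @strict_point [pred i | i != j] (tight j) _ _
    (supporting_mid (supporting_tight j)).
- by exists z.
- by move=> x [].
- apply: contrapT => nstrict.
  have tji x : tight j x -> dotp x 'p_i = dotp 'p_i 'p_i.
    move=> tx; apply/eqP; rewrite eq_le (proj1 tx i) leNgt; apply/negP => xi.
    by apply: nstrict; exists x.
  have VH k : (forall x, tight j x -> dotp x 'p_k = dotp 'p_k 'p_k) ->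
      {in V, forall v, dotp v 'p_k = 0}.
    move=> tk v vV; apply/eqP; rewrite -mem_hyperplane; apply: subvP vV.
    by apply: Vmin => x y tx ty; rewrite mem_hyperplane dotpBl !tk// subrr.
  have [|c cE] := hyperplane_normal dV (p0 j) (VH j _) (VH i tji).
    by move=> x [].
  have := tji z (conj Qz zj); rewrite cE dotpZr dotpZl dotpZr zj.
  have c0 : c != 0 by apply: contraNneq (p0 i) => c0; rewrite cE c0 scale0r.
  move=> /(mulfI c0); rewrite -[LHS]mul1r => /mulIf c1.
  have /c1 c1E : dotp 'p_j 'p_j != 0 by rewrite gt_eqF// dotp_gt0.
  move/eqP: ij; apply; apply: tinj; rewrite /tight cE -c1E; apply/seteqP.
  by split=> y; rewrite scale1r.
- by exists x.
Qed.

End Facets.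

(** * Every polyhedron with 0 in its interior is some [Qset p] *)

Section OntoPolyhedra.
Variables (R : realType) (d : nat).
Implicit Types P : set 'rV[R]_d.

Lemma polyhedron_Qset P : polyhedron P -> P° 0 ->
  exists k (p : 'M[R]_(k, d)), (forall j, row j p != 0) /\ Qset p = P.
Proof.
move=> [k [a [b [a0 PE]]]] P0.
(* A small multiple [e *: a i] still lies in [P], so [b i] is at least [e * dotp (a i) (a i)]. *)
have b0 i : 0 < b i.
  have : (fun e : R => e *: a i) @ 0^'+ --> (0 : R) *: a i.
    by apply: cvg_at_right_filter; apply: cvgZr_tmp; exact: cvg_id.
  rewrite scale0r => /(_ _ P0) /= H.
  near (0 : R)^'+ => e.
  have : P (e *: a i) by near: e.
  rewrite PE => /(_ i); rewrite dotpZl; apply: lt_le_trans.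
  by rewrite mulr_gt0// dotp_gt0.
(* [c i *: a i] is the foot of the perpendicular from 0 to the [i]-th hyperplane. *)
pose c i := b i / dotp (a i) (a i).
have c0 i : 0 < c i by rewrite divr_gt0// dotp_gt0.
exists k, (\matrix_i (c i *: a i)); split=> [j|].
  by rewrite rowK scaler_eq0 negb_or a0 gt_eqF.
rewrite PE; apply/seteqP; split=> x Hx j; have := Hx j.
all: rewrite rowK !dotpZr dotpZl ler_pM2l// /c divfK//.
all: by rewrite gt_eqF// dotp_gt0.
Unshelve. all: by end_near. Qed.

(** Induction on the number of rows: a row that violates irredundance is deleted, which leaves the
    polyhedron unchanged. *)
Lemma exists_irredundant k (p : 'M[R]_(k, d)) : (forall j, row j p != 0) ->
  exists k' (p' : 'M[R]_(k', d)),
    [/\ forall j, row j p' != 0, Qset p' = Qset p & irredundant p'].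
Proof.
elim: k p => [|k IHk] p p0.
  by exists 0%N, p; split => // -[].
have [irr|/existsNP[j nj]] := pselect (irredundant p); first by exists k.+1, p.
have [i|k' [p' [p'0 p'E irr]]] := IHk (row' j p).
  by rewrite (_ : row i _ = row (lift j i) p)//; apply/rowP => l; rewrite !mxE.
have rowl i : row i (row' j p) = row (lift j i) p.
  by apply/rowP => l; rewrite !mxE.
exists k', p'; split=> //; rewrite p'E; apply/seteqP; split=> x Qx i; last first.
  by rewrite rowl; exact: Qx.
have xl i' : i' != j -> dotp x (row i' p) <= dotp (row i' p) (row i' p).
  by case: (unliftP j i') => [l ->|->]; rewrite ?eqxx// -rowl => _; exact: Qx.
have [->|/xl//] := eqVneq i j.
(* Otherwise the segment from 0 to x crosses the j-th hyperplane at a point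
   where all other constraints are strict. *)
rewrite leNgt; apply/negP => xj; apply: nj.
have pp l : 0 < dotp (row l p) (row l p) by exact: dotp_gt0.
have xj0 : 0 < dotp x (row j p) by exact: lt_trans (pp j) xj.
exists ((dotp (row j p) (row j p) / dotp x (row j p)) *: x).
  by rewrite dotpZl divfK// gt_eqF.
move=> l lj; rewrite dotpZl.
set t := _ / _; have t0 : 0 < t by rewrite divr_gt0.
have t1 : t < 1 by rewrite ltr_pdivrMr// mul1r.
apply: (@le_lt_trans _ _ (t * dotp (row l p) (row l p))).
  by rewrite ler_pM2l// xl.
by rewrite gtr_pMl.
Qed.

Lemma polyhedronN_Qset N P : (0 < d)%N -> is_polyhedronN N P ->
  exists2 p : 'M[R]_(N, d), Udom p & Qset p = P.
Proof.
move=> d0 [pP _ P0 PN].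
have [k [p [p0 QP]]] := polyhedron_Qset pP P0.
have [k' [q [q0 QE irr]]] := exists_irredundant p0.
have qk := irredundant_card d0 q0 irr.
have /card_eq_II kN : (`I_k' #= `I_N)%card.
  by rewrite (card_eq_trans _ PN)// card_eq_sym -QP -QE.
subst k'; exists q; last by rewrite QE.
by split=> //.
Qed.

End OntoPolyhedra.

(** * General position expressed by the rows of [p] *)

Section GeneralPosition.
Variables (R : realType) (d N : nat) (p : 'M[R]_(N, d)).
Hypotheses (d_gt0 : (0 < d)%N) (dN : (d <= N)%N) (pU : Udom p).
Let p0 : forall j, row j p != 0 := proj1 pU.

Definition generic :=
  (forall f : 'I_d -> 'I_N, injective f -> \det (rowsub f p) != 0) /\
  (forall f : 'I_d.+1 -> 'I_N, injective f -> forall v, Qset p v ->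
    ~ forall i, dotp v (row (f i) p) = dotp (row (f i) p) (row (f i) p)).

Lemma row_free_rowsub m n k (A : 'M[R]_(m, n)) (h : 'I_k -> 'I_m) :
  injective h -> row_free A -> row_free (rowsub h A).
Proof.
move=> hinj Afree; rewrite -(mul1mx A) -mul_rowsub_mx /row_free mxrankMfree//.
rewrite -/(row_free _); apply/row_freeP; exists (rowsub h 1%:M)^T.
apply/matrixP => i j; rewrite !mxE (bigD1 (h i))//= !mxE eqxx mul1r.
rewrite big1 ?addr0; first by rewrite eq_sym (inj_eq hinj).
by move=> l li; rewrite !mxE eq_sym (negbTE li) mul0r.
Qed.

(** Reduces independence of at most [d] rows to that of exactly [d]. List the values of [f] first,
    then the other indices; as [d <= N], the first [d] entries define [g]. *)
Lemma extend_injection k (f : 'I_k -> 'I_N) : injective f -> (k <= d)%N ->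
  exists (g : 'I_d -> 'I_N) (h : 'I_k -> 'I_d),
    [/\ injective g, injective h & f =1 g \o h].
Proof.
move=> finj kd; pose s := codom f ++ [seq j <- enum 'I_N | j \notin codom f].
have s_uniq : uniq s.
  rewrite cat_uniq filter_uniq ?enum_uniq// andbT codomE map_inj_uniq// enum_uniq /=.
  by apply/hasPn => j; rewrite mem_filter => /andP[].
have ss : size s = N.
  rewrite -[RHS](size_enum_ord N); apply: perm_size; apply: uniq_perm => //.
    exact: enum_uniq.
  by move=> j; rewrite mem_cat mem_filter mem_enum /= andbT orbN.
have j0 : 'I_N by exact: widen_ord dN (Ordinal d_gt0).
exists (fun i => nth j0 s i), (widen_ord kd); split=> [i j||i].
- move/eqP; rewrite nth_uniq// ?ss; last 2 first.
    by apply: leq_trans dN.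
    by apply: leq_trans dN.
  by move/eqP/val_inj.
- by move=> i j /(congr1 val) /= ij; exact: val_inj.
- rewrite /= nth_cat size_codom card_ord ltn_ord codomE (nth_map i) ?nth_ord_enum//.
  by rewrite size_enum_ord.
Qed.

Lemma generic_row_free k (f : 'I_k -> 'I_N) : generic -> injective f ->
  (k <= d)%N -> row_free (rowsub f p).
Proof.
move=> [gen _] finj kd; have [g [h [ginj hinj fE]]] := extend_injection finj kd.
have -> : rowsub f p = rowsub h (rowsub g p).
  by apply/matrixP => i j; rewrite !mxE fE.
by apply: row_free_rowsub; rewrite // row_free_unit unitmxE unitfE gen.
Qed.

Lemma row_free_scale k (f : 'I_k -> 'I_N) (c : 'I_k -> R) :
  (forall i, c i != 0) ->
  row_free (rowsub f p) -> row_free (\matrix_i (c i *: row (f i) p)).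
Proof.
move=> c0 pfree; rewrite (_ : \matrix_i _ = diag_mx (\row_i c i) *m rowsub f p).
  rewrite /row_free mxrankMfree// mxrank_unit// unitmxE det_diag unitfE.
  by apply/prodf_neq0 => i _; rewrite mxE.
by apply/matrixP => i j; rewrite mul_diag_mx !mxE.
Qed.

Lemma outer_normal_tight j n : outer_normal (Qset p) (tight p j) n ->
  exists2 c, c != 0 & n = c *: row j p.
Proof.
move=> [n0 [m sn]]; have [tF tinj] := card_tight d_gt0 p0 (proj2 pU).
have [i [c [c0 nE /tinj ji]]] := facet_normal d_gt0 p0 sn (proj2 (tF j)).
by exists c; rewrite ?gt_eqF// nE ji.
Qed.

Lemma generic_normals k (F : 'I_k -> set 'rV[R]_d) (n : 'I_k -> 'rV[R]_d) :
  generic -> (k <= d)%N -> injective F -> (forall i, facets (Qset p) (F i)) ->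
  (forall i, outer_normal (Qset p) (F i) (n i)) -> row_free (\matrix_i n i).
Proof.
move=> gen kd Finj FF Fn.
have /choice[f fE] : forall i, exists j, F i = tight p j.
  by move=> i; exact: facet_tight (FF i).
have finj : injective f by move=> i j fij; apply: Finj; rewrite !fE fij.
have /choice[c cE] : forall i, exists c, c != 0 /\ n i = c *: row (f i) p.
  by move=> i; have := Fn i; rewrite fE => /outer_normal_tight[c]; exists c.
rewrite (_ : \matrix_i n i = \matrix_i (c i *: row (f i) p)); last first.
  by apply/matrixP => i j; rewrite !mxE (proj2 (cE i)) !mxE.
by apply: row_free_scale => [i|]; [have [] := cE i|exact: generic_row_free].
Qed.

Lemma generic_general_position : generic -> general_position (Qset p).
Proof.
move=> gen; split=> [S SF Sd k F n Finj FS|v [w [m [_ vE]]] k F n Finj Fv].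
  (* [k <= d] holds because [F] embeds ['I_k] into [S], which has [d] members. *)
  apply: generic_normals => // [|i]; last exact/SF.
  have /subset_card_le : F @` [set: 'I_k] `<=` S by move=> _ [i _ <-].
  have Fk : (F @` [set: 'I_k] #= [set: 'I_k])%card.
    by apply: inj_card_eq => i j _ _; exact: Finj.
  by rewrite (card_le_eqr Sd) (card_le_eql Fk) -(card_le_eql card_II) card_le_II.
(* More than [d] facets through [v] would put [v] on [d + 1] of the hyperplanes, against the second
   clause of [generic]. *)
have [kd|dk] := leqP k d.
  by apply: generic_normals => // i; have [] := Fv i.
have Qv : Qset p v by have : [set v] v by []; rewrite vE => -[].
have /choice[f fE] : forall i, exists j, F i = tight p j.
  by move=> i; apply: facet_tight => //; have [] := Fv i.
have finj : injective f by move=> i j fij; apply: Finj; rewrite !fE fij.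
case: (proj2 gen (f \o widen_ord dk) _ v Qv) => [i j /= /finj/(congr1 val) /= ij|i].
  exact: val_inj.
by have [_] := Fv (widen_ord dk i); rewrite fE => -[].
Qed.

(** If [d + 1] hyperplanes met at a point [v] of [Qset p], then [v] would be a vertex, and general
    position would yield [d + 1] independent vectors in dimension [d]. *)
Lemma general_position_generic : general_position (Qset p) -> generic.
Proof.
move=> [gp1 gp2]; have [tF tinj] := card_tight d_gt0 p0 (proj2 pU).
have tn j : outer_normal (Qset p) (tight p j) (row j p).
  by split=> //; exists (dotp (row j p) (row j p)); exact: supporting_tight.
have rowsubE k (f : 'I_k -> 'I_N) : rowsub f p = \matrix_i row (f i) p.
  by apply/matrixP => i j; rewrite !mxE.
have free (f : 'I_d -> 'I_N) : injective f -> row_free (rowsub f p).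
  move=> finj; rewrite rowsubE.
  apply: (gp1 ((tight p \o f) @` setT) _ _ d (tight p \o f)).
  - by move=> _ [i _ <-]; exact: tF.
  - apply: (@card_eq_trans _ _ _ _ [set: 'I_d]); last first.
      by rewrite card_eq_sym; exact: card_II.
    by apply: inj_card_eq => i j _ _ /tinj/finj.
  - exact: inj_comp.
  - by move=> i; exists i.
  - by move=> i; exact: tn.
split=> [f /free|f finj v Qv vf].
  by rewrite row_free_unit unitmxE unitfE.
pose g i := f (widen_ord (leqnSn d) i).
have ginj : injective g by move=> i j /finj/(congr1 val) /= ij; exact: val_inj.
(* The sum of d of the active normals exposes v, since these normals span. *)
have vv : vertex (Qset p) v.
  exists (\sum_i row (g i) p), (\sum_i dotp (row (g i) p) (row (g i) p)); split.
    by move=> x Qx /=; rewrite dotp_sumr ler_sum// => i _; exact: Qx.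
  apply/seteqP; split=> [_ ->|x [Qx /=]].
    by split=> //=; rewrite dotp_sumr; apply: eq_bigr => i _; exact: vf.
  rewrite dotp_sumr => xE.
  have xg i : dotp x (row (g i) p) = dotp v (row (g i) p).
    rewrite vf; apply/eqP; rewrite -subr_eq0 -oppr_eq0 opprB.
    have : \sum_i (dotp (row (g i) p) (row (g i) p) - dotp x (row (g i) p)) = 0.
      by rewrite sumrB xE subrr.
    by move/psumr_eq0P => ->// j _; rewrite subr_ge0; exact: Qx.
  apply/eqP; rewrite -subr_eq0 -trmx_eq0; apply/eqP.
  have := free g ginj; rewrite row_free_unit => gU.
  rewrite -[LHS](mulKmx gU) (_ : rowsub g p *m _ = 0) ?mulmx0//.
  apply/colP => i; rewrite mulmx_dotp [RHS]mxE.
  rewrite (_ : row i _ = row (g i) p); last by apply/rowP => l; rewrite !mxE.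
  by rewrite dotpBl xg subrr.
have := @gp2 v vv d.+1 (tight p \o f) (fun i => row (f i) p).
move=> /(_ (inj_comp tinj finj)) H.
have : row_free (\matrix_i row (f i) p).
  by apply: H => i; [split; [exact: tF|split]|exact: tn].
by move=> /eqP rk; have := rank_leq_col (\matrix_i row (f i) p); rewrite rk ltnn.
Qed.

End GeneralPosition.

(** * Polynomial functions of the entries of a matrix *)

Section PolynomialFunctions.
Variables (R : realType) (N d : nat).
Implicit Types (f g : 'M[R]_(N, d) -> R) (p a b : 'M[R]_(N, d)).

(** An inductive predicate on functions, so that continuity, measurability and restriction to
    polynomial curves follow by induction. *)
Inductive polyfun : ('M[R]_(N, d) -> R) -> Prop :=
| polyfun_cst c : polyfun (fun=> c)
| polyfun_coord i j : polyfun (fun p => p i j)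
| polyfunD f g : polyfun f -> polyfun g -> polyfun (fun p => f p + g p)
| polyfunM f g : polyfun f -> polyfun g -> polyfun (fun p => f p * g p).

Lemma polyfun_sum (I : Type) (r : seq I) (P : pred I) F :
  (forall i, polyfun (F i)) -> polyfun (fun p => \sum_(i <- r | P i) F i p).
Proof.
move=> FP; elim: r => [|i r IHr].
  by under eq_fun do rewrite big_nil; exact: polyfun_cst.
under eq_fun do rewrite big_cons.
by case: (P i) => //; exact: polyfunD.
Qed.

Lemma polyfun_prod (I : Type) (r : seq I) (P : pred I) F :
  (forall i, polyfun (F i)) -> polyfun (fun p => \prod_(i <- r | P i) F i p).
Proof.
move=> FP; elim: r => [|i r IHr].
  by under eq_fun do rewrite big_nil; exact: polyfun_cst.
under eq_fun do rewrite big_cons.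
by case: (P i) => //; exact: polyfunM.
Qed.

Lemma polyfun_det k (A : 'M[R]_(N, d) -> 'M[R]_k) :
  (forall i j, polyfun (fun p => A p i j)) -> polyfun (fun p => \det (A p)).
Proof.
move=> AP; apply: polyfun_sum => s; apply: polyfunM; first exact: polyfun_cst.
by apply: polyfun_prod => i; exact: AP.
Qed.

Lemma polyfun_adj k (A : 'M[R]_(N, d) -> 'M[R]_k) i j :
  (forall i j, polyfun (fun p => A p i j)) ->
  polyfun (fun p => (\adj (A p)) i j).
Proof.
move=> AP; under eq_fun do rewrite mxE.
apply: polyfunM; first exact: polyfun_cst.
by apply: polyfun_det => i' j'; under eq_fun do rewrite !mxE.
Qed.

Lemma continuous_polyfun f : polyfun f -> continuous f.
Proof.
elim=> [c|i j|f1 f2 _ c1 _ c2|f1 f2 _ c1 _ c2] p.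
- exact: cst_continuous.
- exact: coord_continuous.
- exact: (@continuousD _ _ _ f1 f2 p (c1 p) (c2 p)).
- exact: (@continuousM _ _ f1 f2 p (c1 p) (c2 p)).
Qed.

Lemma polyfun_subst f : polyfun f -> forall P : 'M[{poly R}]_(N, d),
  exists q : {poly R}, forall x, f (map_mx (horner^~ x) P) = q.[x].
Proof.
elim=> [c|i j|f1 f2 _ IH1 _ IH2|f1 f2 _ IH1 _ IH2] P.
- by exists c%:P => x; rewrite hornerC.
- by exists (P i j) => x; rewrite mxE.
- have [q1 E1] := IH1 P; have [q2 E2] := IH2 P.
  by exists (q1 + q2) => x; rewrite hornerD E1 E2.
- have [q1 E1] := IH1 P; have [q2 E2] := IH2 P.
  by exists (q1 * q2) => x; rewrite hornerM E1 E2.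
Qed.

Lemma polyfun_line f a b : polyfun f ->
  exists q : {poly R}, forall t, f (a + t *: (b - a)) = q.[t].
Proof.
move=> /polyfun_subst/(_ (\matrix_(i, j) ((a i j)%:P + (b i j - a i j)%:P * 'X))).
move=> [q qE]; exists q => t; rewrite -qE; congr f; apply/matrixP => i j.
by rewrite !mxE !hornerE mulrC.
Qed.

Lemma poly_nonroot (q : {poly R}) e : q != 0 -> 0 < e ->
  exists2 t, 0 < t < e & q.[t] != 0.
Proof.
move=> q0 e0; apply: contrapT => nt.
(* These are [size q] distinct points, more than [q] can have roots; the shift by 2 keeps them
   strictly below [e]. *)
pose s := [seq e / (k.+2)%:R | k <- iota 0 (size q)].
have := @max_poly_roots R q s q0; rewrite size_map size_iota ltnn.
move=> absurd; suff : false by []; apply: absurd.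
  apply/allP => _ /mapP[k _ ->]; rewrite rootE; apply: contrapT => qk.
  apply: nt; exists (e / (k.+2)%:R); last exact/negP.
  by rewrite divr_gt0//= ltr_pdivrMr// ltr_pMr// ltr1n.
rewrite map_inj_uniq ?iota_uniq// => i j /(mulfI (lt0r_neq0 e0)) /invr_inj.
by move=> /eqP; rewrite eqr_nat => /eqP[].
Qed.

(** On the line from [a] to [b], [f] is a polynomial nonzero at 0 and [g] one nonzero at 1; their
    product is a nonzero polynomial and has a nonroot. *)
Lemma polyfun_neq0_mul f g a b : polyfun f -> polyfun g ->
  f a != 0 -> g b != 0 -> exists c, f c * g c != 0.
Proof.
move=> fP gP fa gb.
have [q qE] := polyfun_line a b fP; have [r rE] := polyfun_line a b gP.
have q0 : q != 0.
  apply: contraNneq fa => q0.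
  by rewrite -[a]addr0 -(scale0r (b - a)) qE q0 horner0.
have r0 : r != 0.
  apply: contraNneq gb => r0.
  by rewrite -[b](addrNK a) addrC -(scale1r (b - a)) rE r0 horner0.
have [|t _] := @poly_nonroot (q * r) 1 _ ltr01; first by rewrite mulf_neq0.
by rewrite hornerM -qE -rE; exists (a + t *: (b - a)).
Qed.

Lemma polyfun_neq0_prod (I : Type) (s : seq I) (F : I -> 'M[R]_(N, d) -> R) :
  (forall i, polyfun (F i)) -> (forall i, exists a, F i a != 0) ->
  exists a, \prod_(i <- s) F i a != 0.
Proof.
move=> FP F0; elim: s => [|i s [a sa]].
  by exists 0; rewrite big_nil oner_eq0.
have [b ib] := F0 i.
have [c] := polyfun_neq0_mul (FP i) (polyfun_prod s xpredT FP) ib sa.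
by exists c; rewrite big_cons.
Qed.

(** On the line from [a] to [b], [f] is a nonzero polynomial, which has nonroots arbitrarily close
    to the parameter 0 of [a]. *)
Lemma polyfun_neq0_dense f a b (V : set 'M[R]_(N, d)) : polyfun f ->
  f b != 0 -> nbhs a V -> exists2 c, V c & f c != 0.
Proof.
move=> fP fb aV; have [q qE] := polyfun_line a b fP.
have q0 : q != 0.
  apply: contraNneq fb => q0.
  by rewrite -[b](addrNK a) addrC -(scale1r (b - a)) qE q0 horner0.
have : (fun t : R => a + t *: (b - a)) @ (0 : R) --> a + 0 *: (b - a).
  by apply: cvgD; [exact: cvg_cst|apply: cvgZr_tmp; exact: cvg_id].
rewrite scale0r addr0 => /(_ _ aV) /nbhs_ballP[e /= e0 eV].
have [t /andP[t0 te] qt] := poly_nonroot q0 e0.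
exists (a + t *: (b - a)); last by rewrite qE.
by apply: eV; rewrite -ball_normE /= sub0r normrN gtr0_norm.
Qed.

End PolynomialFunctions.

(** * Zero sets of nonzero polynomials are null *)

Section NullSets.
Variable R : realType.
Local Notation tup n := (n.-tuple (measurableTypeR R)).

Lemma poly_zeros_countable (q : {poly R}) : q != 0 ->
  countable [set x | q.[x] = 0].
Proof.
move=> q0; apply: finite_set_countable; apply: contrapT.
move=> /(infinite_set_fset (size q))[B BQ]; apply/negP; rewrite -ltnNge.
apply: max_poly_roots => //; first by apply/allP => x /BQ /eqP.
exact: finmap.fset_uniq.
Qed.

(** Fubini and induction on [n]. Outside a countable set [T] of first coordinates, the slice of [h]
    is nonzero somewhere and its zero set is null by induction. Polynomiality is stated along
    polynomial curves, a form that passes to slices. *)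
Lemma lebesgue_tuple_zeros n (h : tup n -> R) :
  measurable_fun setT h ->
  (forall P : n.-tuple {poly R}, exists q : {poly R}, forall x : R,
     h [tuple ((tnth P i).[x] : measurableTypeR R) | i < n] = q.[x]) ->
  (exists t, h t != 0) ->
  lebesgue_tuple R n [set t | h t = 0] = 0%E.
Proof.
elim: n h => [|n IHn] h mh hP [t ht].
  (* In dimension 0 the measure is the Dirac mass at the empty tuple, where [h] does not vanish. *)
  rewrite /= diracE; apply/eqP; rewrite eqe pnatr_eq0 eqb0; apply/negP.
  by rewrite inE /= => h0; move: ht; rewrite [t]tuple0 h0 eqxx.
have mcons : measurable_fun setT
    (fun z : measurableTypeR R * tup n => [tuple of z.1 :: z.2]).
  exact: measurable_cons.
have mB : measurable [set z : measurableTypeR R * tup n |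
    h [tuple of z.1 :: z.2] = 0].
  have := measurableT_comp mh mcons.
  move=> /(_ measurableT _ (measurable_set1 (0 : R))); rewrite setTI.
  exact.
rewrite /= /lebesgue_cons /pushforward /product_measure1 /=.
set B := (X in xsection X).
set T := [set x : measurableTypeR R | h [tuple of x :: behead_tuple t] = 0].
have tE : t = [tuple of thead t :: behead_tuple t].
  by apply: val_inj; rewrite /= [in LHS](tuple_eta t).
have cT : countable T.
  (* Only the first coordinate varies; the others are frozen at those of [t]. *)
  have [q qE] := hP [tuple of 'X :: map_tuple polyC (behead_tuple t)].
  have hq x : h [tuple of x :: behead_tuple t] = q.[x].
    rewrite -qE; congr h; apply: eq_from_tnth => i; rewrite tnth_mktuple.
    case: (unliftP ord0 i) => [j ->|->]; last by rewrite !tnth0 hornerX.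
    by rewrite !tnthS tnth_map hornerC.
  rewrite (_ : T = [set x | q.[x] = 0]); last first.
    by apply/seteqP; split => x; rewrite /T /= hq.
  apply: poly_zeros_countable; apply: contraNneq ht => q0.
  by rewrite tE hq q0 horner0.
rewrite (@ge0_negligible_integral _ _ _ _ _ T)//.
- apply: integral0_eq => x [_ Tx].
  rewrite (_ : xsection B x = [set u : tup n | h [tuple of x :: u] = 0]); last first.
    by apply/seteqP; split => u; rewrite /xsection /= inE.
  apply: IHn.
  + by apply: measurableT_comp => //; exact: measurable_cons.
  + move=> P; have [q qE] := hP [tuple of x%:P :: P]; exists q => y.
    rewrite -qE; congr h; apply: eq_from_tnth => i; rewrite tnth_mktuple.
    case: (unliftP ord0 i) => [j ->|->]; last by rewrite !tnth0 hornerC.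
    by rewrite !tnthS tnth_mktuple.
  + by exists (behead_tuple t); apply/eqP.
- have mx : measurable_fun setT (fun x : measurableTypeR R =>
      [tuple of x :: behead_tuple t]) by exact: measurable_cons.
  have := measurableT_comp mh mx.
  by move=> /(_ measurableT _ (measurable_set1 (0 : R))); rewrite setTI.
- exact: measurable_fun_xsection.
- exact: countable_lebesgue_measure0.
Qed.

End NullSets.

Lemma lebesgue_mx_zeros (R : realType) (N d : nat) (g : 'M[R]_(N, d) -> R) a :
  polyfun g -> g a != 0 -> lebesgue_mx [set p | g p = 0] = 0%E.
Proof.
move=> gP ga.
pose mx (t : (N * d).-tuple (measurableTypeR R)) : 'M[R]_(N, d) :=
  vec_mx (\row_k (tnth t k : R)).
pose tup (p : 'M[R]_(N, d)) : (N * d).-tuple (measurableTypeR R) :=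
  [tuple (mxvec p ord0 k : measurableTypeR R) | k < N * d].
have tupK : cancel tup mx.
  move=> p; rewrite /mx (_ : \row_k _ = mxvec p) ?mxvecK//.
  by apply/rowP => k; rewrite mxE tnth_mktuple.
have mg : measurable_fun setT (g \o mx).
  elim: gP => [c|i j|f1 f2 _ m1 _ m2|f1 f2 _ m1 _ m2].
  - exact: measurable_cst.
  - rewrite (_ : _ \o _ = fun t => tnth t (mxvec_index i j)).
      exact: measurable_tnth.
    by apply/funext => t; rewrite /= !mxE.
  - exact: measurable_realfun.measurable_funD.
  - exact: measurable_realfun.measurable_funM.
have g0 : lebesgue_tuple R (N * d) [set t | (g \o mx) t = 0] = 0%E.
  apply: lebesgue_tuple_zeros => // [P|]; last by exists (tup a); rewrite /= tupK.
  have [q qE] := polyfun_subst gP (vec_mx (\row_k tnth P k)); exists q => x.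
  rewrite -qE /=; congr g; apply/matrixP => i j.
  by rewrite !mxE tnth_mktuple.
apply/eqP; rewrite eq_le outer_measure_ge0 andbT -g0.
(* On the Borel zero set the outer measure agrees with the measure. *)
rewrite -measurable_mu_extE; last first.
  by have := mg measurableT _ (measurable_set1 (0 : R)); rewrite setTI.
by apply: le_outer_measure => _ [p gp <-] /=; rewrite tupK.
Qed.

(** * Genericity through polynomial conditions *)

Section Genericity.
Variables (R : realType) (N d : nat).
Implicit Types (p : 'M[R]_(N, d)) (f : 'I_d.+1 -> 'I_N) (v : 'rV[R]_d).

Local Notation sqn p j := (dotp (row j p) (row j p)).
Local Notation init f := (fun i : 'I_d => f (widen_ord (leqnSn d) i)).

(* By Cramer's rule, \det (rowsub (init f) p) times the common point of the
   first d hyperplanes selected by f. *)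
Definition cramer f p : 'rV[R]_d :=
  (\adj (rowsub (init f) p) *m \col_i sqn p (init f i))^T.

(** The amount by which the common point violates constraint [j], times the squared determinant:
    this clears denominators and preserves the sign. *)
Definition excess f j p : R :=
  \det (rowsub (init f) p) * dotp (cramer f p) (row j p) -
  \det (rowsub (init f) p) ^+ 2 * sqn p j.

Lemma row_rowsub k (h : 'I_k -> 'I_N) p i : row i (rowsub h p) = row (h i) p.
Proof. by apply/rowP => j; rewrite !mxE. Qed.

Lemma cramer_scale f p v :
  (forall i, dotp v (row (init f i) p) = sqn p (init f i)) ->
  cramer f p = \det (rowsub (init f) p) *: v.
Proof.
move=> vf; rewrite /cramer (_ : \col_i _ = rowsub (init f) p *m v^T).
  by rewrite mulmxA mul_adj_mx mul_scalar_mx linearZ /= trmxK.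
by apply/colP => i; rewrite mulmx_dotp row_rowsub mxE vf.
Qed.

Lemma excessE f p v j :
  (forall i, dotp v (row (init f i) p) = sqn p (init f i)) ->
  excess f j p =
  \det (rowsub (init f) p) ^+ 2 * (dotp v (row j p) - sqn p j).
Proof. by move=> /cramer_scale vf; rewrite /excess vf dotpZl mulrA mulrBr. Qed.

Lemma cramer_sol f p : \det (rowsub (init f) p) != 0 ->
  exists v, forall i, dotp v (row (init f i) p) = sqn p (init f i).
Proof.
set D := \det _ => D0; exists (D^-1 *: cramer f p) => i.
rewrite dotpZl -[row _ p in LHS](row_rowsub (init f)) -mulmx_dotp /cramer trmxK.
rewrite mulmxA mul_mx_adj.
by rewrite mul_scalar_mx -/D !mxE mulKf.
Qed.

Lemma polyfun_dotp (u w : 'M[R]_(N, d) -> 'rV[R]_d) :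
  (forall i, polyfun (fun p => u p ord0 i)) ->
  (forall i, polyfun (fun p => w p ord0 i)) ->
  polyfun (fun p => dotp (u p) (w p)).
Proof. by move=> uP wP; apply: polyfun_sum => i; exact: polyfunM. Qed.

Lemma polyfun_row j i : polyfun (fun p => row j p ord0 i).
Proof. by under eq_fun do rewrite mxE; exact: polyfun_coord. Qed.

Lemma polyfun_sqn j : polyfun (fun p => sqn p j).
Proof. by apply: polyfun_dotp => i; exact: polyfun_row. Qed.

Lemma polyfun_minor k (h : 'I_k -> 'I_N) (c : 'I_k -> 'I_d) :
  polyfun (fun p => \det (mxsub h c p)).
Proof.
by apply: polyfun_det => i j; under eq_fun do rewrite mxE; exact: polyfun_coord.
Qed.

Lemma polyfunB (g h : 'M[R]_(N, d) -> R) : polyfun g -> polyfun h ->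
  polyfun (fun p => g p - h p).
Proof.
move=> gP hP; under eq_fun do rewrite -mulN1r.
by apply: polyfunD => //; apply: polyfunM => //; exact: polyfun_cst.
Qed.

Lemma polyfun_excess f j : polyfun (excess f j).
Proof.
have DP : polyfun (fun p => \det (rowsub (init f) p)) by exact: polyfun_minor.
apply: polyfunB; last first.
  by apply: polyfunM; [exact: polyfunM|exact: polyfun_sqn].
apply: polyfunM => //; apply: polyfun_dotp => i; last exact: polyfun_row.
under eq_fun do rewrite !mxE; apply: polyfun_sum => k; apply: polyfunM.
  apply: polyfun_adj => i' j'.
  by under eq_fun do rewrite mxE; exact: polyfun_coord.
by under eq_fun do rewrite mxE; exact: polyfun_sqn.
Qed.

(** A common point of [d + 1] hyperplanes makes the excess vanish. The hypothesis also excludes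
    common points outside [Qset p], so that it only asks finitely many polynomials not to vanish. *)
Lemma generic_excess p :
  (forall f : 'I_d.+1 -> 'I_N, injective f -> excess f (f ord_max) p != 0) ->
  (forall f : 'I_d -> 'I_N, injective f -> \det (rowsub f p) != 0) ->
  generic p.
Proof.
move=> pe pd; split=> // f finj v _ vf.
have := pe f finj; rewrite (@excessE f p v) => [|i]; last exact: vf.
by rewrite vf subrr mulr0 eqxx.
Qed.

Lemma polyfun_near_neq0 (g : 'M[R]_(N, d) -> R) p : polyfun g -> g p != 0 ->
  \forall q \near p, g q != 0.
Proof.
move=> /continuous_polyfun/(_ p) gp g0.
exact: (cvgr_neq0 _ gp g0).
Qed.

Lemma polyfun_near_gt0 (g : 'M[R]_(N, d) -> R) p : polyfun g -> 0 < g p ->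
  \forall q \near p, 0 < g q.
Proof.
by move=> /continuous_polyfun/(_ p) gp g0; exact: (cvgr_gt _ gp _ g0).
Qed.

(** For each choice of [d + 1] hyperplanes, either they have no common point, or that point violates
    a constraint [j]. A nonzero excess at the last hyperplane, respectively a positive excess at
    [j], certifies this and persists near [p]. *)
Lemma open_generic : open [set p : 'M[R]_(N, d) | generic p].
Proof.
rewrite openE => p [pd pv].
(* Finite functions form a finite type, so [filter_forall] applies. *)
have near_det : \forall q \near p, forall f : {ffun 'I_d -> 'I_N},
    injective f -> \det (rowsub f q) != 0.
  apply: (@filter_forall _ _ _ (nbhs p)) => f; have [/pd fp|nf] := pselect (injective f).
    by have := polyfun_near_neq0 (polyfun_minor f id) fp; apply: filterS.
  by apply: nearW => q.
have near_excess : \forall q \near p, forall f : {ffun 'I_d.+1 -> 'I_N},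
    injective f -> excess f (f ord_max) q != 0 \/
    exists j, 0 < excess f j q.
  apply: (@filter_forall _ _ _ (nbhs p)) => f.
  have [finj|nf] := pselect (injective f); last first.
    by apply: nearW => q.
  have D0 : \det (rowsub (init f) p) != 0.
    by apply: pd => i j /finj/(congr1 val) /= ij; exact: val_inj.
  have [v vf] := cramer_sol D0.
  have [e0|e0] := eqVneq (excess f (f ord_max) p) 0; last first.
    have := polyfun_near_neq0 (polyfun_excess f _) e0.
    by apply: filterS => q; left.
  have vmax : dotp v (row (f ord_max) p) = sqn p (f ord_max).
    apply/eqP; move/eqP: e0; rewrite (excessE _ vf) mulf_eq0 expf_eq0 /=.
    by rewrite (negbTE D0) subr_eq0.
  have [j vj] : exists j, sqn p j < dotp v (row j p).
    apply: contrapT => /forallNP vQ; apply: (pv f finj v) => [j|i].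
      by rewrite leNgt; exact/negP/vQ.
    have [id|di] := ltnP i d.
      by have := vf (Ordinal id); rewrite (_ : widen_ord _ _ = i)//; exact: val_inj.
    rewrite (_ : i = ord_max)//; apply/val_inj/eqP.
    by rewrite eqn_leq di -ltnS ltn_ord.
  have := @polyfun_near_gt0 _ p (polyfun_excess f j).
  rewrite (excessE _ vf) mulr_gt0 ?subr_gt0 ?exprn_even_gt0//.
  by move=> /(_ isT); apply: filterS => q ?; right; exists j.
apply: filterS2 near_det near_excess => q qd qe.
split=> [f finj|f finj v Qv vf].
  by have := qd (finfun f); rewrite (funext (ffunE f)); exact.
have := qe (finfun f); rewrite (funext (ffunE f)) => /(_ finj) [].
  by rewrite (@excessE f q v) => [|i//]; rewrite vf subrr mulr0 eqxx.
move=> [j]; rewrite (@excessE f q v) => [|i]; last exact: vf.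
apply/negP; rewrite -leNgt mulr_ge0_le0 ?sqr_ge0// subr_le0; exact: Qv.
Qed.

Lemma dotp_delta x i : dotp x (delta_mx ord0 i : 'rV[R]_d) = x ord0 i.
Proof.
rewrite /dotp (bigD1 i)//= mxE !eqxx mulr1 big1 ?addr0// => j ji.
by rewrite mxE (negbTE ji) andbF mulr0.
Qed.

Lemma minor_neq0 (f : 'I_d -> 'I_N) : injective f ->
  exists p, \det (rowsub f p) != 0.
Proof.
move=> finj; exists (\matrix_(j, l) (j == f l)%:R).
rewrite (_ : rowsub _ _ = 1%:M) ?det1 ?oner_eq0//.
by apply/matrixP => i j; rewrite !mxE (inj_eq finj).
Qed.

Lemma excess_neq0 f : (0 < d)%N -> injective f ->
  exists p, excess f (f ord_max) p != 0.
Proof.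
move=> d0 finj; pose i0 := Ordinal d0.
(* The first [d] selected rows are the standard basis, so the common point is [const_mx 1]. The last
   is twice a basis vector, whose hyperplane misses that point since 2 differs from 4. *)
pose p : 'M[R]_(N, d) := \matrix_(j, l)
  if j == f ord_max then 2 * (l == i0)%:R else (j == init f l)%:R.
have fmax i : init f i == f ord_max = false.
  apply/negbTE; rewrite (inj_eq finj) -val_eqE /=.
  by rewrite neq_ltn ltn_ord.
have initE i j : (init f i == init f j) = (i == j).
  by rewrite (inj_eq finj) -!val_eqE.
have rinit i : row (init f i) p = delta_mx ord0 i.
  by apply/rowP => l; rewrite !mxE fmax initE eqxx /= eq_sym.
have rmax : row (f ord_max) p = 2 *: delta_mx ord0 i0.
  by apply/rowP => l; rewrite !mxE !eqxx.
exists p; rewrite (@excessE f p (const_mx 1)); last first.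
  by move=> i; rewrite rinit !dotp_delta !mxE !eqxx.
rewrite (_ : rowsub _ p = 1%:M); last first.
  by apply/matrixP => i j; rewrite !mxE fmax initE.
rewrite det1 expr1n mul1r rmax !dotpZr dotpZl !dotp_delta !mxE !eqxx !mulr1.
by rewrite subr_eq0 -natrM eqr_nat.
Qed.

Lemma polyfun_generic : (0 < d)%N -> exists g : 'M[R]_(N, d) -> R,
  [/\ polyfun g, exists a, g a != 0 & forall p, g p != 0 -> generic p].
Proof.
move=> d0.
(* One factor per condition; index maps that are not injective contribute the harmless factor 1. *)
pose F (s : {ffun 'I_d -> 'I_N} + {ffun 'I_d.+1 -> 'I_N}) p : R :=
  match s with
  | inl f => if injectiveb f then \det (rowsub f p) else 1
  | inr f => if injectiveb f then excess f (f ord_max) p else 1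
  end.
have FP s : polyfun (F s).
  case: s => f; rewrite /F; case: (injectiveb f).
  - exact: polyfun_minor.
  - exact: polyfun_cst.
  - exact: polyfun_excess.
  - exact: polyfun_cst.
have F0 s : exists a, F s a != 0.
  case: s => f; rewrite /F; case: (injectiveP f) => [finj|_].
  - exact: minor_neq0.
  - by exists 0; exact: oner_neq0.
  - exact: excess_neq0.
  - by exists 0; exact: oner_neq0.
exists (fun p => \prod_s F s p); split.
- exact: polyfun_prod.
- exact: polyfun_neq0_prod.
- move=> p /prodf_neq0 Fp; apply: generic_excess => f finj.
    have := Fp (inr (finfun f)) isT; rewrite /F.
    by case: injectiveP; rewrite (funext (ffunE f)).
  have := Fp (inl (finfun f)) isT; rewrite /F.
  by case: injectiveP; rewrite (funext (ffunE f)).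
Qed.

End Genericity.

(** * Stability of the facet count and of compactness *)

Section OpenConditions.
Variables (R : realType) (d N : nat).
Implicit Types (p q : 'M[R]_(N, d)).

(** The irredundance witness [x] at [p] is kept fixed and rescaled for each [q]. With the positive
    denominator [dotp x (row j q)] cleared, its conditions are strict polynomial inequalities in
    [q], which persist. *)
Lemma near_Udom p : (0 < d)%N -> Udom p -> \forall q \near p, Udom q.
Proof.
move=> d0 [p0 pN]; have irr := card_irredundant d0 p0 pN.
have near_rows : \forall q \near p, forall j, row j q != 0.
  apply: (@filter_forall _ _ _ (nbhs p)) => j.
  have := polyfun_near_neq0 (polyfun_sqn R d j) (lt0r_neq0 (dotp_gt0 (p0 j))).
  by apply: filterS => q; apply: contraNneq => ->; rewrite dotp0l.
have near_irr : \forall q \near p, forall j, exists x : 'rV[R]_d,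
    0 < dotp x (row j q) /\ forall i, i != j ->
    0 < dotp (row i q) (row i q) * dotp x (row j q) -
        dotp (row j q) (row j q) * dotp x (row i q).
  apply: (@filter_forall _ _ _ (nbhs p)) => j.
  have [x xj xi] := irr j.
  have xP k : polyfun (fun q : 'M[R]_(N, d) => dotp x (row k q)).
    by apply: polyfun_dotp => i; [exact: polyfun_cst|exact: polyfun_row].
  have near1 : \forall q \near p, 0 < dotp x (row j q).
    by apply: polyfun_near_gt0; rewrite // xj dotp_gt0.
  pose h i q := dotp (row i q) (row i q) * dotp x (row j q) -
    dotp (row j q) (row j q) * dotp x (row i q).
  have hP i : polyfun (h i).
    by apply: polyfunB; apply: polyfunM => //; exact: polyfun_sqn.
  have near2 : \forall q \near p, forall i, i != j -> 0 < h i q.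
    apply: (@filter_forall _ _ _ (nbhs p)) => i.
    have [->|ij] := eqVneq i j; first by apply: nearW.
    have h0 : 0 < h i p.
      by rewrite /h xj mulrC -mulrBr mulr_gt0 ?subr_gt0 ?xi// dotp_gt0.
    by apply: filterS (polyfun_near_gt0 (hP i) h0).
  by apply: filterS2 near1 near2 => q q1 q2; exists x.
apply: filterS2 near_rows near_irr => q q0 qirr; split=> //.
apply: irredundant_card => // j; have [x [xj xi]] := qirr j.
(* Rescaling x moves it onto the hyperplane of the j-th row of q. *)
exists ((dotp (row j q) (row j q) / dotp x (row j q)) *: x).
  by rewrite dotpZl divfK// gt_eqF.
by move=> i /xi; rewrite subr_gt0 dotpZl mulrAC ltr_pdivrMr.
Qed.

Lemma closed_Qset p : closed (Qset p).
Proof.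
rewrite (_ : Qset p = \bigcap_j [set x | dotp x (row j p) <= dotp (row j p) (row j p)]).
  apply: closed_bigI => j _.
  apply: (@closed_comp _ _ (fun x => dotp x (row j p))
    [set t : R | t <= dotp (row j p) (row j p)]); last exact: closed_le.
  by move=> x _; exact: continuous_dotp.
by apply/seteqP; split=> x Qx j => [_|]; [exact: Qx|exact: (Qx j I)].
Qed.

Lemma Qset_scale p x t : 0 <= t <= 1 -> Qset p x -> Qset p (t *: x).
Proof.
move=> /andP[t0 t1] Qx j; rewrite dotpZl.
have pj0 : 0 <= dotp (row j p) (row j p).
  by apply: sumr_ge0 => i _; rewrite -expr2 sqr_ge0.
apply: (@le_trans _ _ (t * dotp (row j p) (row j p))).
  by rewrite ler_wpM2l// Qx.
by rewrite ler_piMl.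
Qed.

Lemma continuous_dotp_row j :
  continuous (fun z : 'rV[R]_d * 'M[R]_(N, d) => dotp z.1 (row j z.2)).
Proof.
apply: continuous_big => [|i _ z]; first exact: add_continuous.
under eq_fun do rewrite mxE.
apply: (@continuousM _ _ (fun z : 'rV[R]_d * 'M[R]_(N, d) => z.1 ord0 i)
  (fun z => z.2 j i)).
  apply: (@continuous_comp _ _ _ fst (fun x : 'rV[R]_d => x ord0 i)).
    exact: cvg_fst.
  exact: coord_continuous.
apply: (@continuous_comp _ _ _ snd (fun q : 'M[R]_(N, d) => q j i)).
  exact: cvg_snd.
exact: coord_continuous.
Qed.

(** A sphere [K] around [Qset p] is compact and misses it, so it misses [Qset q] for [q] near [p].
    As [Qset q] is star-shaped about 0, it cannot reach beyond [K]. *)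
Lemma near_compact p : compact (Qset p) -> \forall q \near p, compact (Qset q).
Proof.
move=> /compact_bounded[M [_ MQ]]; pose B := `|M| + 1.
have B0 : 0 < B + 1 by rewrite ltr_wpDl ?addr_ge0.
have QB x : Qset p x -> `|x| <= B.
  by apply: MQ; rewrite /B (le_lt_trans (ler_norm M))// ltrDl.
pose K : set 'rV[R]_d := [set x | `|x| = B + 1].
have cK : compact K.
  apply: bounded_closed_compact.
    by exists (B + 1); split=> [|b Bb y Ky]; [exact: num_real|rewrite /= Ky ltW].
  apply: (@closed_comp _ _ (fun x : 'rV[R]_d => `|x|) [set B + 1]).
    by move=> x _; exact: norm_continuous.
  exact: closed_eq.
have far x : K x -> \forall y \near x & q \near p, ~ Qset q y.
  move=> Kx; have [j xj] : exists j, dotp (row j p) (row j p) < dotp x (row j p).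
    apply: contrapT => /forallNP Qx.
    have /QB : Qset p x by move=> j; rewrite leNgt; exact/negP/Qx.
    by rewrite Kx gerDl ler10.
  have sq : {for (x, p), continuous (fun z : 'rV[R]_d * 'M[R]_(N, d) =>
      dotp (row j z.2) (row j z.2))}.
    apply: (@continuous_comp _ _ _ snd (fun q => dotp (row j q) (row j q))).
      exact: cvg_snd.
    exact: (continuous_polyfun (polyfun_sqn R d j)).
  have phi := continuousB (@continuous_dotp_row j (x, p)) sq.
  have := @cvgr_gt _ _ (nbhs (x, p)) _ _ _ phi 0.
  rewrite subr_gt0 => /(_ (nbhs_filter _) xj).
  apply: filterS => -[y q] /=; rewrite fctE subr_gt0 => yq /(_ j).
  by rewrite leNgt yq.
(* Compactness of [K] gives one neighbourhood of [p] valid for all its points. *)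
have near_far : \forall q \near p, K `<=` (fun y => ~ Qset q y).
  exact: (iffLR (compact_near_coveringP K) cK _ (nbhs p) _ _ far).
apply: filterS near_far => q Kq; apply: bounded_closed_compact; last first.
  exact: closed_Qset.
exists (B + 1); split=> [|b Bb x Qx]; first exact: num_real.
apply: (le_trans _ (ltW Bb)); rewrite leNgt; apply/negP => xB.
have x0 : 0 < `|x| by exact: lt_trans xB.
apply: (Kq (((B + 1) / `|x|) *: x)).
  by rewrite /K /= normrZ gtr0_norm ?divr_gt0// divfK// gt_eqF.
apply: Qset_scale Qx; rewrite divr_ge0 ?ltW//=.
by rewrite ltr_pdivrMr// mul1r.
Qed.

(** Fewer than [d] rows have a nonzero common orthogonal vector, and the line it spans lies in
    [Qset p]. *)
Lemma compact_leq p : compact (Qset p) -> (d <= N)%N.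
Proof.
move=> /compact_bounded[M [_ MQ]]; rewrite leqNgt; apply/negP => Nd.
have : kermx p^T != 0.
  rewrite kermx_eq0; apply/negP => /eqP rk.
  by have := rank_leq_col p^T; rewrite rk leqNgt Nd.
move=> /rowV0Pn[x /sub_kermxP xp x0].
have Qx t : Qset p (t *: x).
  move=> j; rewrite dotpZl (_ : dotp x _ = 0).
    by rewrite mulr0; apply: sumr_ge0 => i _; rewrite -expr2 sqr_ge0.
  have := congr1 (fun A : 'rV[R]_N => A ord0 j) xp; rewrite !mxE => <-.
  by apply: eq_bigr => i _; rewrite !mxE.
have Mlt : M < `|M| + 1 by rewrite (le_lt_trans (ler_norm M))// ltrDl.
have := MQ _ Mlt _ (Qx ((`|M| + 2) / `|x|)).
rewrite /= normrZ ger0_norm ?divr_ge0 ?addr_ge0// divfK ?normr_eq0//.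
by rewrite lerD2l leNgt ltr1n.
Qed.

End OpenConditions.

(** * Transfer to the space of polyhedra through [Q] *)

Section SpaceOfPolyhedra.
Variables (R : realType) (d N : nat).
Hypothesis d_gt0 : (0 < d)%N.

Lemma Q_onto (P : polyhedraN R d N) : exists u, Q u = P.
Proof.
case: P => P PN; have [p pU pP] := polyhedronN_Qset d_gt0 PN.
exists (SigSub (mem_set pU)); apply: eq_sig_hprop => //=.
Qed.

Lemma polytopesN_leq (P : polytopesN R d N) : (d <= N)%N.
Proof.
have := set_valP P; have [u <-] := Q_onto (\val P); exact: compact_leq.
Qed.

End SpaceOfPolyhedra.

Theorem proposition3p2 (R : realType) (d N : nat) (hd : (2 <= d)%N) :
  [/\ open (general_polytopesN R d N),
      dense (general_polytopesN R d N) &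
      lebesgue_polyhedraN (set_val @` (~` general_polytopesN R d N)) = 0%E].
Proof.
have d0 : (0 < d)%N by exact: ltn_trans hd.
have gpE (u : @Udom R d N) : (d <= N)%N ->
    general_position (Qset (\val u)) <-> generic (\val u).
  move=> dN; have Uu := set_valP u; split.
    exact: general_position_generic.
  exact: generic_general_position.
have [g [gP [a ga] g_generic]] := polyfun_generic R N d0.
split.
(* For [N < d] there are no polytopes, so the set is empty. *)
- have [dN|Nd] := leqP d N; last first.
    rewrite (_ : general_polytopesN R d N = set0); first exact: open0.
    by apply/seteqP; split=> // P; have := polytopesN_leq d0 P; rewrite leqNgt Nd.
  exists [set P : polyhedraN R d N | general_position (sval P)] => //.
  exists [set p : 'M[R]_(N, d) | generic p]; first exact: open_generic.
  by apply/seteqP; split=> u /(gpE u dN).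
- move=> O [P OP] [V [W oW WV] VO]; have dN := polytopesN_leq d0 P.
  have [u uP] := Q_onto d0 (\val P).
  have WVE (v : @Udom R d N) : W (\val v) = V (Q v).
    by rewrite -[LHS]/((set_val @^-1` W) v) WV.
  have Wu : W (\val u) by rewrite WVE uP; move: OP; rewrite -VO.
  (* Near a parameter [u] of [P], every matrix still parametrises a polytope in the given open set;
     one of them avoids the zeros of [g]. *)
  have near_u : \forall q \near (\val u : 'M[R]_(N, d)),
      [/\ W q, Udom q & compact (Qset q)].
    have cu : compact (Qset (\val u)).
      by have := set_valP P; rewrite -uP.
    have nW := open_nbhs_nbhs (conj oW Wu).
    have nU := near_Udom d0 (set_valP u).
    have nc := near_compact cu.
    by apply: filterS3 nW nU nc.
  have [q [Wq Uq cq] gq] := polyfun_neq0_dense gP ga near_u.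
  pose uq : @Udom R d N := SigSub (mem_set Uq).
  pose Pq : polytopesN R d N := SigSub (mem_set (cq : polytopesN R d N (Q uq))).
  exists Pq; split.
    by rewrite -VO /= -[V _]/(V (Q uq)) -WVE.
  exact/(gpE uq dN)/g_generic.
(* Every parameter of a polytope not in general position is a zero of [g]. *)
- apply/eqP; rewrite eq_le outer_measure_ge0 andbT -(lebesgue_mx_zeros gP ga).
  apply: le_outer_measure => _ [u [P nP PE] <-] /=; apply: contrapT => /eqP gu.
  have {}PE : \val P = Q u by exact: PE.
  apply: nP; rewrite /general_polytopesN /= PE.
  exact/(gpE u (polytopesN_leq d0 P))/g_generic.
Qed.
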